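(* For every integer $n>3$, there are infinitely many pairwise non-isomorphic regular maniplexes of rank $n$ that are faithful and thin but are not polytopal.
   Context: For a natural number $n$, $[n]=\{0,\dots,n-1\}$. A maniplex of rank $n$ (an $n$-maniplex) is a finite, simple, connected, $n$-valent graph $\mathcal M$ together with a proper edge-colouring $c\colon E(\mathcal M)\to[n]$ such that whenever $|i-j|>1$, every connected subgraph induced by the edges of colours $i$ and $j$ is a $4$-cycle. Vertices are called flags and edges links; two flags joined by a link of colour $i$ are $i$-adjacent. An automorphism of $\mathcal M$ is a colour-preserving graph automorphism; $\mathcal M$ is regular if its automorphism group acts transitively on flags. For $J\subseteq[n]$, $\mathcal M_J$ is the subgraph spanned by links with colours in $J$. An $i$-face ($i\in[n]$) is a connected component of $\mathcal M_{[n]\setminus\{i\}}$; in addition $\mathcal M$ has two improper faces of ranks $-1$ and $n$, incident to all faces. The poset $\mathrm{Pos}(\mathcal M)$ is the set of faces with $F\le G$ iff $F\cap G\neq\emptyset$ (improper faces being incident to everything) and $\mathrm{rank}(F)\le\mathrm{rank}(G)$; it is a flagged poset of rank $n$ (unique minimum and maximum, all maximal chains of length $n+2$). $\mathcal M$ is thin if $\mathrm{Pos}(\mathcal M)$ satisfies: for every $i\in[n]$ and every pair of elements $F_{i-1}\le F_{i+1}$ of ranks $i-1$ and $i+1$, there are exactly two elements $F_i$ of rank $i$ with $F_{i-1}\le F_i\le F_{i+1}$. $\mathcal M$ is faithful if for every flag $\Phi$, the intersection of all faces (of ranks $0,\dots,n-1$) containing $\Phi$ consists of $\Phi$ alone.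 Two maximal chains are $i$-adjacent if they differ only in their element of rank $i$. A flagged poset is strongly connected if for any two maximal chains $\Phi,\Psi$ there is a sequence $\Phi=\Phi_0,\dots,\Phi_k=\Psi$ of maximal chains each containing $\Phi\cap\Psi$, with consecutive chains $i_j$-adjacent for some $i_j\in[n]$. An abstract $n$-polytope is a thin, strongly connected flagged poset of rank $n$. $\mathcal M$ is polytopal if $\mathrm{Pos}(\mathcal M)$ is an abstract $n$-polytope. *)

(* Defs.v *)
From HB Require Import structures.
From mathcomp Require Import all_boot all_order all_algebra zify.

Set Implicit Arguments.
Unset Strict Implicit.
Unset Printing Implicit Defensive.

Import Order.TTheory GRing.Theory Num.Theory.
Local Open Scope ring_scope.

(* A finite simple graph with an edge-colouring in {0, ..., n-1}: the pair
   {x, y} is an edge of colour i iff link x y = Some i, and a non-edge iff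
   link x y = None. *)
Record coloured_graph (n : nat) := ColouredGraph {
  flag :> finType;
  link : flag -> flag -> option 'I_n;
  link_sym : forall x y, link x y = link y x;
  link_irr : forall x, link x x = None
}.

Section ColouredGraph.
Variables (n : nat) (G : coloured_graph n).
Implicit Types (J : {set 'I_n}) (x y z : G).

Definition adjacent : rel G := fun x y => isSome (link x y).

Definition restrict J : rel G :=
  fun x y => [exists i in J, link x y == Some i].

Definition component J x : {set G} := [set y | connect (restrict J) x y].

Definition is_connected := (0 < #|G|)%N /\ (forall x y, connect adjacent x y).

Definition is_valent (k : nat) := forall x, #|[set y | adjacent x y]| = k.

Definition properly_coloured :=
  forall x y z i, link x y = Some i -> link x z = Some i -> y = z.

Definition is_four_cycle (e : rel G) (A : {set G}) :=
  exists s : seq G, [/\ size s = 4%N, uniq s, A =i s &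
    {in A &, forall y z, e y z = (z == next s y) || (y == next s z)}].

Definition far_colours_four_cycles :=
  forall i j : 'I_n, (i.+1 < j)%N || (j.+1 < i)%N ->
  forall x, is_four_cycle (restrict [set i; j]) (component [set i; j] x).

End ColouredGraph.

Record maniplex (n : nat) := Maniplex {
  maniplex_graph :> coloured_graph n;
  maniplex_connected : is_connected maniplex_graph;
  maniplex_valent : is_valent maniplex_graph n;
  maniplex_proper : properly_coloured maniplex_graph;
  maniplex_four_cycles : far_colours_four_cycles maniplex_graph
}.

Definition is_isomorphism n (M N : maniplex n) (f : M -> N) :=
  bijective f /\ forall x y, link (f x) (f y) = link x y.

Definition isomorphic n (M N : maniplex n) :=
  exists f : M -> N, is_isomorphism f.

Definition regular n (M : maniplex n) :=
  forall x y : M, exists f : M -> M, is_isomorphism f /\ f x = y.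

(* A face of rank r is encoded by the pair (r + 1, A), where A is its set of
   flags; the rank is part of the data because components for different ranks
   may have the same flags.  No colour equals r for r = -1 and r = n, so there
   A is the set of all flags: this gives exactly one face of each of these two
   ranks, incident to every face. *)
Definition colours_but n (r : 'I_n.+2) : {set 'I_n} := [set c : 'I_n | c.+1 != r].

Record face n (M : maniplex n) := Face {
  face_data : 'I_n.+2 * {set M};
  face_dataP : [exists x, face_data.2 == component (colours_but face_data.1) x]
}.

HB.instance Definition _ n (M : maniplex n) := [isSub for @face_data n M].
HB.instance Definition _ n (M : maniplex n) := [Finite of face M by <:].

Section Faces.
Variables (n : nat) (M : maniplex n).
Implicit Types F G H : face M.

Definition rank F : int := (val F).1%:Z - 1.

Definition flags F : {set M} := (val F).2.

Definition face_le : rel (face M) :=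
  fun F G => (flags F :&: flags G != set0) && (rank F <= rank G).

Lemma restrict_sym (J : {set 'I_n}) : symmetric (@restrict n M J).
Proof. by move=> x y; rewrite /restrict; apply: eq_existsb => i; rewrite link_sym. Qed.

Lemma connect_restrictC (J : {set 'I_n}) : connect_sym (@restrict n M J).
Proof. exact/sym_connect_sym/restrict_sym. Qed.

Lemma flags_component F x : x \in flags F ->
  flags F = component (colours_but (val F).1) x.
Proof.
rewrite /flags; case: F => -[r A] /= /existsP[y /eqP/= ->].
rewrite inE => yx; apply/setP => z; rewrite !inE.
by apply: same_connect => //; apply: connect_restrictC.
Qed.

Lemma restrictP (J : {set 'I_n}) (x y : M) :
  reflect (exists2 i, i \in J & link x y = Some i) (restrict J x y).
Proof.
apply: (iffP existsP) => [[i /andP[iJ /eqP e]]|[i iJ e]]; exists i => //.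
by rewrite iJ e /=.
Qed.

Lemma far_commute (i j : 'I_n) (x y z : M) : (i.+1 < j)%N || (j.+1 < i)%N ->
  link x y = Some i -> link y z = Some j ->
  exists2 w, link x w = Some j & link w z = Some i.
Proof.
move=> ij xy yz; have [s [ss us As es]] := maniplex_four_cycles ij y.
have nij : i != j by apply/eqP => e; move: ij; rewrite e; lia.
have yx : link y x = Some i by rewrite link_sym.
set A := component _ y in As es.
have R (a b : M) k : k = i \/ k = j -> link a b = Some k -> restrict [set i; j] a b.
  by case=> -> e; apply/restrictP; [exists i|exists j] => //; rewrite !inE eqxx ?orbT.
have yA : y \in A by rewrite inE connect0.
have Ryx : restrict [set i; j] y x by apply: R yx; left.
have Ryz : restrict [set i; j] y z by apply: R yz; right.
have xA : x \in A by rewrite inE connect1.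
have zA : z \in A by rewrite inE connect1.
clearbody A.
have nxz : x != z.
  by apply/eqP => e; move: yx; rewrite e yz => -[/eqP]; rewrite eq_sym (negPf nij).
have nxy : x != y by apply/eqP => e; move: xy; rewrite e link_irr.
have nzy : z != y by apply/eqP => e; move: yz; rewrite e link_irr.
have [w [wA wy Rxw Rwz]] : exists w, [/\ w \in A, w != y,
    restrict [set i; j] x w & restrict [set i; j] w z].
  have ys : y \in s by rewrite -As.
  have [k t rt] := rot_to ys.
  have st : size t = 3%N by have := congr1 size rt; rewrite size_rot ss => -[].
  have uyt : uniq (y :: t) by rewrite -rt rot_uniq.
  have At (a : M) : (a \in A) = (a \in y :: t) by rewrite As -rt mem_rot.
  have et : {in A &, forall a b, restrict [set i; j] a b =
      (b == next (y :: t) a) || (a == next (y :: t) b)}.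
    by move=> a b aA bA; rewrite es // -rt !next_rot.
  clear rt ys; case: t st uyt At et => [|a [|b [|c [|]]]] // _ uyt At et.
  have bA : b \in A by rewrite At !inE eqxx !orbT.
  exists b; move: (xA) (zA) Ryx Ryz; rewrite !et //.
  move: uyt; rewrite /= !inE !negb_or -!andbA.
  case/and5P=> ya yb yc ab /and3P[ac bc _].
  rewrite !At !inE (negPf nxy) (negPf nzy) /=.
  have nE := (negPf ya, negPf yb, negPf yc, negPf ab, negPf ac, negPf bc).
  have nE' := (eq_sym a y, eq_sym b y, eq_sym c y, eq_sym b a, eq_sym c a, eq_sym c b, nE).
  case/or3P=> /eqP ex; case/or3P=> /eqP ez; subst x z; move: nxz;
    by rewrite ?eqxx ?nE' /= ?eqxx ?nE' /= ?eqxx ?nE' // orbT.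
case/restrictP: Rxw => k; rewrite !inE => /orP[]/eqP-> xw.
  by rewrite (maniplex_proper xw xy) eqxx in wy.
exists w => //; case/restrictP: Rwz => k'; rewrite !inE => /orP[]/eqP-> wz //.
have zw : link z w = Some j by rewrite link_sym.
have zy : link z y = Some j by rewrite link_sym.
by rewrite (maniplex_proper zw zy) eqxx in wy.
Qed.

Lemma connect_split (r : 'I_n.+2) (x y : M) : connect (restrict (colours_but r)) x y ->
  exists2 z, connect (restrict [set c : 'I_n | (c.+1 < r)%N]) x z &
             connect (restrict [set c : 'I_n | (r < c.+1)%N]) z y.
Proof.
set J := [set c : 'I_n | (c.+1 < r)%N]; set K := [set c : 'I_n | (r < c.+1)%N].
have slide (a b c : M) : restrict K a b -> connect (restrict J) b c ->
    exists2 d, connect (restrict J) a d & restrict K d c.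
  move=> ab /connectP[p pp ->] {c}; elim: p a b ab pp => [|c p IH] a b ab /=.
    by exists a; rewrite ?connect0.
  case/andP=> bc; case/restrictP: ab bc => i iK ab /restrictP[j jJ bc] pp.
  have [|d ad dc] := far_commute _ ab bc; first by move: iK jJ; rewrite !inE; lia.
  have [|e de ec] := IH d c _ pp; first by apply/restrictP; exists i.
  exists e => //; apply: connect_trans de; apply: connect1.
  by apply/restrictP; exists j.
case/connectP=> p pp -> {y}; elim: p x pp => [|a p IH] x /=.
  by exists x; rewrite connect0.
case/andP=> /restrictP[i iI xa] /IH[z az zy].
have [iJ|iK] : i \in J \/ i \in K by move: iI; rewrite !inE; lia.
  by exists z => //; apply: connect_trans az; apply: connect1; apply/restrictP; exists i.
have [|d xd dz] := @slide x a z _ az; first by apply/restrictP; exists i.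
by exists d => //; apply: connect_trans zy; apply: connect1.
Qed.

Lemma flags_connect (J : {set 'I_n}) F x y : J \subset colours_but (val F).1 ->
  connect (restrict J) x y -> x \in flags F -> y \in flags F.
Proof.
move=> sJ xy /flags_component ->; rewrite inE; apply: connect_sub xy => a b.
by case/restrictP=> i iJ ab; apply/connect1/restrictP; exists i; rewrite ?(subsetP sJ).
Qed.

Lemma rank_leE F G : (rank F <= rank G) = ((val F).1 <= (val G).1)%N.
Proof. rewrite /rank; lia. Qed.

(* Two flags x and y of the same face G yield one flag common to every face through x of rank
   at most rank G and every face through y of rank at least rank G. *)
Lemma common_flag G x y : x \in flags G -> y \in flags G ->
  exists z, (forall F, rank F <= rank G -> x \in flags F -> z \in flags F) /\
            (forall H, rank G <= rank H -> y \in flags H -> z \in flags H).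
Proof.
move=> xG yG; have := yG; rewrite (flags_component xG) inE connect_restrictC.
case/connect_split=> z yz zx; exists z; split=> F; rewrite rank_leE => rF.
  rewrite connect_restrictC in zx; apply: flags_connect zx.
  by apply/subsetP=> c; rewrite !inE; lia.
by apply: flags_connect yz; apply/subsetP=> c; rewrite !inE; lia.
Qed.

Lemma flags_neq0 F : exists x, x \in flags F.
Proof.
rewrite /flags; case: F => -[r A] /= /existsP[y /eqP/= ->].
by exists y; rewrite inE connect0.
Qed.

Lemma face_eq F G x : rank F = rank G -> x \in flags F -> x \in flags G -> F = G.
Proof.
move=> rFG xF xG; have e : (val F).1 = (val G).1.
  by apply/val_inj; move: rFG; rewrite /rank /=; lia.
have {xF xG} : flags F = flags G.
  by rewrite (flags_component xF) (flags_component xG) e.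
move: e {rFG}; rewrite /flags => e1 e2; apply: val_inj.
by move: e1 e2; case: (val F) (val G) => [r A] [s B] /= -> ->.
Qed.

Lemma face_le_refl : reflexive face_le.
Proof.
move=> F; rewrite /face_le lexx andbT; apply/set0Pn.
by have [x xF] := flags_neq0 F; exists x; rewrite inE xF.
Qed.

Lemma face_le_anti : antisymmetric face_le.
Proof.
move=> F G; case/andP=> /andP[/set0Pn[x]]; rewrite inE => /andP[xF xG] FG.
by case/andP=> _ GF; apply: face_eq xF xG; apply/eqP; rewrite eq_le FG.
Qed.

Lemma face_le_trans : transitive face_le.
Proof.
move=> G F H /andP[/set0Pn[x]]; rewrite inE => /andP[xF xG] FG.
case/andP=> /set0Pn[y]; rewrite inE => /andP[yG yH] GH.
rewrite /face_le (le_trans FG GH) andbT; apply/set0Pn.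
have [z [zF zH]] := common_flag xG yG.
by exists z; rewrite inE zF // zH.
Qed.

End Faces.

HB.instance Definition _ n (M : maniplex n) :=
  Order.Le_isPOrder.Build (Order.Disp tt tt) (face M)
    (@face_le_refl n M) (@face_le_anti n M) (@face_le_trans n M).

Section FlaggedPoset.
Variables (d : Order.disp_t) (n : nat) (P : finPOrderType d) (rk : P -> int).
Implicit Types (C D : {set P}).

Definition is_chain C := [forall x in C, forall y in C, (x >=< y)%O].

Definition is_maximal_chain C := maxset is_chain C.

(* The last clause says that rk is the rank function of P, which is thereby
   determined by the order; Pos_flagged proves it for the ranks of faces. *)
Definition is_flagged_poset :=
  [/\ exists b : P, forall x, (b <= x)%O,
      exists t : P, forall x, (x <= t)%O,
      forall C, is_maximal_chain C -> #|C| = n.+2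
    & forall C, is_maximal_chain C ->
        {in C, forall x, rk x = #|[set y in C | (y < x)%O]|%:Z - 1}].

Definition is_thin_poset :=
  forall (i : 'I_n) (x z : P), rk x = i%:Z - 1 -> rk z = i%:Z + 1 -> (x <= z)%O ->
  #|[set y | [&& rk y == i%:Z, (x <= y)%O & (y <= z)%O]]| = 2%N.

Definition chain_adjacent (i : 'I_n) : rel {set P} := fun C D =>
  (C != D) && [forall x, (rk x != i%:Z) ==> ((x \in C) == (x \in D))].

Definition is_strongly_connected_poset :=
  forall C D, is_maximal_chain C -> is_maximal_chain D ->
  exists s : seq {set P},
    [/\ path (fun X Y => [exists i, chain_adjacent i X Y]) C s, last C s = D
      & {in s, forall X, is_maximal_chain X /\ C :&: D \subset X}].

Definition is_abstract_polytope :=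
  [/\ is_flagged_poset, is_thin_poset & is_strongly_connected_poset].

End FlaggedPoset.

Section FlaggedPos.
Variables (n : nat) (M : maniplex n).
Implicit Types (F G H : face M) (x y : M) (C : {set face M}).

Lemma face_atP (r : 'I_n.+2) x :
  [exists y, component (colours_but r) x == component (colours_but r) y].
Proof. by apply/existsP; exists x. Qed.

Definition face_at (r : 'I_n.+2) x : face M :=
  @Face n M (r, component (colours_but r) x) (face_atP r x).

Lemma flags_face_at r x : x \in flags (face_at r x).
Proof. by rewrite inE connect0. Qed.

Lemma face_at_inj x : injective (face_at^~ x).
Proof. by move=> r s /(congr1 (fun F => (val F).1)). Qed.

Lemma face_atE F x : x \in flags F -> F = face_at (val F).1 x.
Proof. by move=> xF; apply: (face_eq _ xF (flags_face_at _ _)). Qed.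

Lemma face_leE F G : (F <= G)%O = face_le F G.
Proof. by []. Qed.

Lemma face_le_flag F G x : x \in flags F -> x \in flags G ->
  (F <= G)%O = (rank F <= rank G).
Proof.
move=> xF xG; rewrite face_leE /face_le; case: (rank F <= rank G); rewrite (andbT, andbF) //.
by apply/set0Pn; exists x; rewrite inE xF.
Qed.

Lemma common_flag_chain C : is_chain C -> exists x, {in C, forall F, x \in flags F}.
Proof.
move=> /forall_inP cC.
have cmp F G : F \in C -> G \in C -> rank F <= rank G -> (F <= G)%O.
  move=> FC GC rFG; case/orP: (forall_inP (cC F FC) G GC) => //.
  rewrite !face_leE /face_le rFG andbT => /andP[/set0Pn[x xI] _].
  by apply/set0Pn; exists x; rewrite setIC.
suff /(_ n.+2)[x xC] k : exists x, forall F, F \in C -> ((val F).1 < k)%N -> x \in flags F.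
  by exists x => F FC; apply: xC.
elim: k => [|k [x IH]].
  by case: (maniplex_connected M) => /card_gt0P[x _] _; exists x.
case: (pickP [pred G in C | (val G).1 == k :> nat]) => [G|no]; last first.
  exists x => F FC; rewrite ltnS leq_eqVlt => /orP[e|]; last exact: IH.
  by have := no F; rewrite /= FC e.
rewrite inE => /andP[GC /eqP Gk].
have fin y : y \in flags G -> (forall F, F \in C -> ((val F).1 < k)%N -> y \in flags F) ->
    exists y, forall F, F \in C -> ((val F).1 < k.+1)%N -> y \in flags F.
  move=> yG yl; exists y => F FC; rewrite ltnS leq_eqVlt => /orP[/eqP e|]; last exact: yl.
  have rFG : rank F = rank G by rewrite /rank e Gk.
  have FG : F = G by apply/le_anti; rewrite !cmp ?rFG.
  by rewrite FG.
case: (pickP [pred H in C | ((val H).1 < k)%N]) => [H0 H0P|no]; last first.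
  have [y yG] := flags_neq0 G; apply: (fin y) => // F FC Fk.
  by have := no F; rewrite /= FC Fk.
case: (arg_maxnP (fun H : face M => nat_of_ord (val H).1) H0P) => H /andP[HC Hk] Hmax.
have rHG : rank H <= rank G by rewrite rank_leE Gk ltnW.
have := cmp _ _ HC GC rHG; rewrite face_leE => /andP[/set0Pn[y] + _].
rewrite inE => /andP[yH yG]; have [z [zl zG]] := common_flag (IH H HC Hk) yH.
apply: (fin z); first exact: zG.
move=> F FC Fk; apply: zl; last exact: IH.
by rewrite rank_leE; apply: Hmax; rewrite /= FC Fk.
Qed.

Lemma maximal_chain_flag C : is_maximal_chain C ->
  exists x, C = [set face_at r x | r : 'I_n.+2].
Proof.
case/maxsetP=> cC maxC; have [x xC] := common_flag_chain cC; exists x.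
apply/esym/maxC; last first.
  by apply/subsetP=> F /xC xF; apply/imsetP; exists (val F).1; last exact: face_atE.
apply/forall_inP => _ /imsetP[r _ ->]; apply/forall_inP => _ /imsetP[s _ ->].
have L := face_le_flag (flags_face_at _ x) (flags_face_at _ x).
by rewrite /Order.comparable !L; apply: le_total.
Qed.

Lemma Pos_flagged : is_flagged_poset n (@rank n M).
Proof.
have [/card_gt0P[x0 _] conn] := maniplex_connected M.
have improper (r : 'I_n.+2) x y :
    r = ord0 \/ r = ord_max -> y \in flags (face_at r x).
  move=> r0; rewrite inE; apply: connect_sub (conn x y) => a b.
  rewrite /adjacent; case e: link => [c|] // _; apply/connect1/restrictP.
  exists c => //; rewrite inE; have := ltn_ord c.
  by case: r0 => ->; rewrite //= => cn; rewrite eqSS neq_ltn cn.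
split.
- exists (face_at ord0 x0) => F; have [x xF] := flags_neq0 F.
  rewrite (@face_le_flag _ _ x) //; last by apply: improper; left.
  by rewrite rank_leE.
- exists (face_at ord_max x0) => F; have [x xF] := flags_neq0 F.
  rewrite (@face_le_flag _ _ x) //; last by apply: improper; right.
  by rewrite rank_leE -ltnS.
- move=> C /maximal_chain_flag[x ->].
  by rewrite card_imset ?card_ord //; apply: face_at_inj.
move=> C /maximal_chain_flag[x ->] _ /imsetP[r _ ->].
suff -> : [set y in [set face_at s x | s : 'I_n.+2] | (y < face_at r x)%O]
    = [set face_at s x | s : 'I_n.+2 & (s < r)%N].
  rewrite card_imset; last exact: face_at_inj.
  rewrite /rank /=; congr (_%:Z - 1).
  have inj : injective (widen_ord (ltnW (ltn_ord r))).
    by move=> a b /(congr1 val)/= e; apply: val_inj.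
  rewrite -[LHS]card_ord -(card_imset _ inj).
  apply: eq_card => s; rewrite inE; apply/imsetP/idP => [[j _ ->] //=|sr].
  by exists (Ordinal sr) => //; apply: val_inj.
apply/setP=> F; rewrite inE.
have L s : (face_at s x < face_at r x)%O = (s < r)%N.
  rewrite lt_leAnge !(face_le_flag (flags_face_at _ x) (flags_face_at _ x)).
  by rewrite !rank_leE -ltnNge andb_idl // => /ltnW.
apply/andP/imsetP => [[/imsetP[s _ ->]]|[s]]; first by rewrite L => sr; exists s; rewrite ?inE.
by rewrite inE => sr ->; rewrite L; split=> //; apply/imsetP; exists s.
Qed.

End FlaggedPos.

Definition thin n (M : maniplex n) := is_thin_poset n (@rank n M).

Definition faithful n (M : maniplex n) := forall x : M,
  \bigcap_(F : face M | (0 <= rank F < n%:Z) && (x \in flags F)) flags F = [set x].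

Definition polytopal n (M : maniplex n) := is_abstract_polytope n (@rank n M).

(* Main.v *)
(* The flags of a regular maniplex are the elements of a group generated by involutions
   r_0, ..., r_(n-1), with g and g r_i joined by a link of colour i, and the i-face through g is
   the coset of the subgroup G_i generated by the r_j with j <> i.  Faithfulness says that the
   G_i intersect trivially, thinness constrains G_(i-1) and G_(i+1) only, whereas strong
   connectivity forces every intersection of the G_i, i in K, to be generated by the r_j, j not
   in K.  We break the last condition for K = {0, 3} by a relation
   (r_0 r_1 r_2)^3 = (r_1 r_2 r_3)^3, whose sides lie in G_3 and G_0 respectively.

   The model is the quotient of the cubic honeycomb {4,3,4} by the lattice spanned by (2,0,0),
   (0,2,0), (1,1,1): the central inversions of a cube and of one of its vertices become equal.
   Infinitely many examples come from mixing with a dihedral group whose reflections are the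
   images of r_1 and r_2 while r_0 and r_3 map to 1: the relation persists there, and so does
   everything that keeps the maniplex faithful and thin, but r_1 r_2 gets arbitrarily large
   order.  For rank n > 4 a central involution is adjoined for every colour i > 3. *)

Require Import Defs.
From mathcomp Require Import all_boot.
From mathcomp Require Import all_order all_algebra fingroup morphism perm zify.

Set Implicit Arguments.
Unset Strict Implicit.
Unset Printing Implicit Defensive.

Import GroupScope.

(** * Subgroups generated by part of a family of generators *)

Lemma gen_ind (gT : finGroupType) (S : {set gT}) (P : gT -> Prop) :
  P 1 -> (forall x s, P x -> s \in S -> P (x * s)) ->
  forall x, x \in <<S>> -> P x.
Proof.
move=> P1 PM x /gen_prodgP[m [c cS ->]].
elim: m c cS => [|m IH] c cS; first by rewrite big_ord0.
by rewrite big_ord_recr; apply: PM => //; apply: IH => i; apply: cS.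
Qed.

Section Parabolic.
Variables (n : nat) (gT : finGroupType) (r : nat -> gT).
Implicit Types (J K : {set 'I_n}) (i j : 'I_n) (x y : gT).

Definition parabolic J : {group gT} := <<[set r i | i : 'I_n in J]>>.

Lemma mem_parabolic J i : i \in J -> r i \in parabolic J.
Proof. by move=> iJ; apply/mem_gen/imsetP; exists i. Qed.

Lemma parabolicS J K : J \subset K -> parabolic J \subset parabolic K.
Proof. by move=> JK; apply/genS/imsetS. Qed.

Lemma parabolic_ind J (P : gT -> Prop) :
  P 1 -> (forall x i, P x -> i \in J -> P (x * r i)) ->
  forall x, x \in parabolic J -> P x.
Proof. by move=> P1 PM; apply: gen_ind => // x _ Px /imsetP[i iJ ->]; apply: PM. Qed.

(** The second subgroup centralises the first, so their join is the set of products. *)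
Lemma parabolicU J K : {in J & K, forall i j, commute (r i) (r j)} ->
  parabolic (J :|: K) \subset parabolic J * parabolic K.
Proof.
move=> JK; have cJK : parabolic K \subset 'C(parabolic J).
  rewrite gen_subG; apply/subsetP => _ /imsetP[k kK ->].
  rewrite /= cent_gen; apply/centP => _ /imsetP[j jJ ->].
  exact/commute_sym/JK.
rewrite -cent_joinEr // gen_subG; apply/subsetP => _ /imsetP[i + ->].
case/setUP=> iJ; first exact/(subsetP (joing_subl _ _))/mem_parabolic.
exact/(subsetP (joing_subr _ _))/mem_parabolic.
Qed.

End Parabolic.

(** * Cayley graphs of groups generated by involutions, as maniplexes *)

Section CayleyManiplex.
Variables (n : nat) (gT : finGroupType) (r : nat -> gT).
Hypothesis gen : parabolic r [set: 'I_n] = [set: gT] :> {set gT}.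
Hypothesis rr : forall i, r i * r i = 1.
Hypothesis far : forall i j, i.+1 < j -> commute (r i) (r j).
Hypothesis ind : forall i : 'I_n, r i \notin parabolic r [set~ i].
Implicit Types (J K : {set 'I_n}) (i j : 'I_n) (x y : gT).

Let par J := parabolic r J.

Lemma invr i : (r i)^-1 = r i.
Proof. by apply/eqP; rewrite eq_invg_mul rr. Qed.

Lemma gen_inj : injective (fun i : 'I_n => r i).
Proof.
move=> i j e; apply/eqP/negPn/negP => ij; case/negP: (ind i).
by rewrite e; apply: mem_parabolic; rewrite !inE eq_sym.
Qed.

Lemma gen_neq1 i : r i != 1.
Proof. by apply/eqP => e; case/negP: (ind i); rewrite e group1. Qed.

Definition cayley_link x y : option 'I_n := [pick i : 'I_n | y == x * r i].

Lemma cayley_linkP x y i : cayley_link x y = Some i <-> y = x * r i.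
Proof.
rewrite /cayley_link; case: pickP => [j /eqP->|no]; last first.
  by split=> // e; have := no i; rewrite e eqxx.
split=> [[->]//|/mulgI]; by move/gen_inj->.
Qed.

Lemma cayley_sym x y : cayley_link x y = cayley_link y x.
Proof.
by apply: eq_pick => i /=; apply/eqP/eqP => ->; rewrite -mulgA rr mulg1.
Qed.

Lemma cayley_irr x : cayley_link x x = None.
Proof.
case e: cayley_link => [i|] //; move/cayley_linkP: e => /eqP.
by rewrite -{1}[x]mulg1 (inj_eq (mulgI x)) eq_sym (negPf (gen_neq1 i)).
Qed.

Definition cayley : coloured_graph n := ColouredGraph cayley_sym cayley_irr.

Lemma cayley_restrictP J (x y : cayley) :
  reflect (exists2 i, i \in J & y = (x : gT) * r i) (restrict J x y).
Proof.
apply: (iffP existsP) => [[i /andP[iJ /eqP/cayley_linkP e]]|[i iJ e]]; exists i => //.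
by rewrite iJ; apply/eqP/cayley_linkP.
Qed.

(** Walking along links multiplies on the right by generators, so components are left cosets and
    incidence becomes subgroup membership. *)
Lemma cayley_connect J (x y : cayley) :
  connect (restrict J) x y = ((x : gT)^-1 * y \in par J).
Proof.
apply/idP/idP.
  case/connectP=> p pp ->; elim: p x pp => [|a p IH] x /=; first by rewrite mulVg group1.
  case/andP=> /cayley_restrictP[i iJ ->] /IH.
  move: (last _ _) => b; rewrite -(groupMl _ (mem_parabolic r iJ)) invMg.
  by rewrite !mulgA mulgV mul1g.
rewrite -{2}[y](mulKVg (x : gT)); move: (_ * y) => z.
move: z; apply: parabolic_ind => [|z i xz iJ]; first by rewrite mulg1 connect0.
by apply: connect_trans xz _; apply/connect1/cayley_restrictP; exists i; rewrite // mulgA.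
Qed.

Lemma cayley_connected : is_connected cayley.
Proof.
split=> [|x y]; first by apply/card_gt0P; exists 1.
have : connect (restrict setT) x y by rewrite cayley_connect /par gen inE.
apply: connect_sub => a b /cayley_restrictP[i _ e]; apply/connect1.
by rewrite /adjacent; move/cayley_linkP: e => /= ->.
Qed.

Lemma cayley_valent : is_valent cayley n.
Proof.
move=> x; rewrite -[RHS]card_ord.
have inj : injective (fun i : 'I_n => (x : gT) * r i).
  by move=> i j /mulgI/gen_inj.
rewrite -(card_imset _ inj); apply: eq_card => y; rewrite !inE.
apply/idP/imsetP => [|[i _ e]]; rewrite /adjacent.
  by case e: link => [i|] // _; exists i => //; apply/cayley_linkP.
by move/cayley_linkP: e => /= ->.
Qed.

Lemma cayley_proper : properly_coloured cayley.
Proof. by move=> x y z i /cayley_linkP-> /cayley_linkP->. Qed.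

Lemma cayley_four_cycles : far_colours_four_cycles cayley.
Proof.
move=> i j ij x.
have c : r i * r j = r j * r i.
  by case/orP: ij => /far c; rewrite // c.
have nij : i != j by apply/eqP => e; move: ij; rewrite e; lia.
have [ni nj] := (gen_neq1 i, gen_neq1 j).
have nrij : r i != r j by rewrite (inj_eq gen_inj).
have nn : r i * r j != 1.
  by rewrite -(rr i) (inj_eq (mulgI _)) eq_sym.
set s : seq gT := [:: (x : gT); x * r i; x * r i * r j; x * r j].
have us : uniq s.
  rewrite /s /= !inE !negb_or -!mulgA !(inj_eq (mulgI _)).
  have x1 (a : gT) : ((x : gT) == x * a) = (1 == a) by rewrite -{1}[x : gT]mulg1 (inj_eq (mulgI _)).
  have i1 : (r i == r i * r j) = (1 == r j) by rewrite -{1}[r i]mulg1 (inj_eq (mulgI _)).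
  have j1 : (r i * r j == r j) = (r i == 1) by rewrite -{2}[r j]mul1g (inj_eq (mulIg _)).
  by rewrite !x1 i1 j1 !(eq_sym 1) ni nj nn nrij.
have E (y z : cayley) : restrict [set i; j] y z = (z == (y : gT) * r i) || (z == (y : gT) * r j).
  apply/cayley_restrictP/orP => [[k]|]; first by rewrite !inE => /orP[]/eqP-> ->; [left|right].
  by case=> /eqP->; [exists i|exists j]; rewrite // !inE eqxx ?orbT.
have iE (a : gT) : a * r i * r i = a by rewrite -mulgA rr mulg1.
have jE (a : gT) : a * r j * r j = a by rewrite -mulgA rr mulg1.
have jiE : x * r i * r j * r i = x * r j by rewrite -[_ * r i * r j]mulgA c mulgA iE.
have ijE : x * r j * r i = x * r i * r j by rewrite -!mulgA c.
have step (y : gT) : y \in s -> y * r i \in s /\ y * r j \in s.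
  rewrite !inE => /or4P[]/eqP->; rewrite ?iE ?jE ?jiE ?ijE ?iE ?jE ?eqxx ?orbT //.
have As (y : cayley) : (y \in component [set i; j] x) = (y \in s).
   rewrite inE cayley_connect; apply/idP/idP.
    rewrite -{2}[y](mulKVg (x : gT)); move: (_ * y) => z.
    move: z; apply: parabolic_ind => [|z k xz]; first by rewrite mulg1 inE eqxx.
    by rewrite mulgA => /set2P[]->; case: (step _ xz).
  have [iJ jJ] : r i \in par [set i; j] /\ r j \in par [set i; j].
    by split; apply: mem_parabolic; rewrite !inE eqxx ?orbT.
  by rewrite !inE => /or4P[]/eqP->; rewrite -?mulgA ?mulKg ?mulVg ?group1 ?groupM.
exists s; split=> // y z; rewrite As => ys _; rewrite E.
(* Both cycle neighbours become functions of [y], to be matched with [y * r i] and [y * r j] in one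
   order or the other. *)
have -> : (y == next s z) = (z == prev s y).
  by rewrite eq_sym; apply: (can2_eq (prev_next us) (next_prev us)).
move: us ys; rewrite /s; move: jiE ijE (iE x) (jE x) (jE (x * r i)).
set a := x * r i * r j; set b := x * r i; set d := x * r j => jiE ijE iE' jE' jbE.
rewrite /= !inE !negb_or -!andbA => /and5P[xb xa xd ba /andP[bd /andP[ad _]]].
have nE := (negPf xb, negPf xa, negPf xd, negPf ba, negPf bd, negPf ad).
have nE' := (eq_sym b x, eq_sym a x, eq_sym d x, eq_sym a b, eq_sym d b, eq_sym d a, nE).
case/or4P=> /eqP->; rewrite ?eqxx ?nE' /= ?eqxx ?nE' /= ?jiE ?ijE ?iE' ?jE' ?jbE // orbC.
all: by rewrite ?jiE ?ijE ?iE' ?jE' ?jbE.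
Qed.

Definition cayley_maniplex : maniplex n :=
  Maniplex cayley_connected cayley_valent cayley_proper cayley_four_cycles.

(** Left translations commute with right multiplication by generators. *)
Lemma cayley_regular : regular cayley_maniplex.
Proof.
move=> x y; exists (fun z => (y : gT) * (x : gT)^-1 * z); split; last exact: mulgKV.
split; first by exists (fun z : gT => (y * x^-1)^-1 * z) => z; rewrite (mulKg, mulKVg).
by move=> a b; apply: eq_pick => i /=; rewrite -[_ * a * _]mulgA (inj_eq (mulgI _)).
Qed.

Lemma mem_face_at (s : 'I_n.+2) (x y : cayley_maniplex) :
  (y \in flags (face_at s x)) = ((x : gT)^-1 * y \in par (colours_but s)).
Proof. by rewrite inE cayley_connect. Qed.

Lemma same_face (F : face cayley_maniplex) (x y : cayley_maniplex) : x \in flags F ->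
  (y \in flags F) = ((x : gT)^-1 * y \in par (colours_but (val F).1)).
Proof. by move=> xF; rewrite {1}(face_atE xF) mem_face_at. Qed.

Definition proper_rank i : 'I_n.+2 := inord i.+1.

Lemma proper_rankE i : proper_rank i = i.+1 :> nat.
Proof. by rewrite inordK // !ltnS ltnW. Qed.

Lemma colours_proper i : colours_but (proper_rank i) = [set~ i].
Proof. by apply/setP => j; rewrite !inE proper_rankE eqSS. Qed.

Lemma rank_face_at i (x : cayley_maniplex) : rank (face_at (proper_rank i) x) = i%:Z%R.
Proof. by rewrite /rank /= proper_rankE; lia. Qed.

Lemma mem_proper_face i (x y : cayley_maniplex) :
  (y \in flags (face_at (proper_rank i) x)) = ((x : gT)^-1 * y \in par [set~ i]).
Proof. by rewrite mem_face_at colours_proper. Qed.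

Lemma proper_face_eq i (F : face cayley_maniplex) (x y : cayley_maniplex) :
  rank F = i%:Z%R -> y \in flags F ->
  (F == face_at (proper_rank i) x) = ((x : gT)^-1 * y \in par [set~ i]).
Proof.
move=> rF yF; rewrite -mem_proper_face; apply/eqP/idP => [<-//|].
by apply: face_eq; rewrite // rank_face_at.
Qed.

Hypothesis trivI : forall x, (forall i, x \in par [set~ i]) -> x = 1.

Lemma cayley_faithful : faithful cayley_maniplex.
Proof.
move=> x; apply/setP => y; rewrite inE; apply/bigcapP/eqP => [yF|-> F /andP[_ //]].
suff /trivI/(canRL (mulKVg _)) : forall i, (x : gT)^-1 * y \in par [set~ i] by rewrite mulg1.
move=> i; rewrite -mem_proper_face; apply: yF.
by rewrite flags_face_at rank_face_at andbT; have := ltn_ord i; lia.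
Qed.

(** The group form of thinness: [x] leads from one flag to another through the same faces of ranks
    i-1 and i+1. At either end of the range one premise is vacuous, the face there being
    improper. *)
Hypothesis diamond : forall i x,
  (forall j, j.+1 = i -> x \in par [set~ j]) ->
  (forall j, j = i.+1 :> nat -> x \in par [set~ j]) ->
  x \in par [set~ i] \/ r i * x \in par [set~ i].

Lemma cayley_diamond i (X Z : face cayley_maniplex) (x y : cayley_maniplex) :
  rank X = (i%:Z - 1)%R -> rank Z = (i%:Z + 1)%R ->
  x \in flags X -> x \in flags Z -> y \in flags X -> y \in flags Z ->
  (x : gT)^-1 * y \in par [set~ i] \/ r i * (x^-1 * y) \in par [set~ i].
Proof.
move=> rX rZ xX xZ yX yZ; apply: diamond => j ji.
  move: yX; rewrite -mem_proper_face; congr (_ \in flags _).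
  by apply: face_eq xX (flags_face_at _ _); rewrite rank_face_at rX -ji; lia.
move: yZ; rewrite -mem_proper_face; congr (_ \in flags _).
by apply: face_eq xZ (flags_face_at _ _); rewrite rank_face_at rZ ji; lia.
Qed.

Lemma cayley_thin : thin cayley_maniplex.
Proof.
move=> i X Z rX rZ XZ; have XleZ : (rank X <= rank Z)%R by rewrite rX rZ; lia.
move: XZ; rewrite face_leE => /andP[/set0Pn[x]]; rewrite inE => /andP[xX xZ] _.
pose y : cayley_maniplex := (x : gT) * r i.
(* Multiplying by [r i] changes only the face of rank i, which yields the second face between [X]
   and [Z]. *)
have step (F : face cayley_maniplex) : rank F <> i%:Z%R -> x \in flags F -> y \in flags F.
  move=> rF xF; rewrite (same_face _ xF) mulKg; apply: mem_parabolic.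
  by move: rF; rewrite !inE /rank; lia.
have [yX yZ] : y \in flags X /\ y \in flags Z by split; apply: step; rewrite ?rX ?rZ //; lia.
have xy : face_at (proper_rank i) x != face_at (proper_rank i) y.
  rewrite (proper_face_eq _ (rank_face_at i x) (flags_face_at _ x)) invMg mulgKV invr.
  exact: ind.
have <- : #|[set face_at (proper_rank i) x; face_at (proper_rank i) y]| = 2 by rewrite cards2 xy.
congr #|pred_of_set _|; apply/setP => F; rewrite !inE; apply/and3P/orP.
  case=> /eqP rF; rewrite !face_leE => /andP[/set0Pn[a + _] /andP[/set0Pn[b + _]]].
  rewrite !inE => /andP[aX aF] /andP[bF bZ].
  (* One flag lying in [X], [F] and [Z] at once, so that the diamond hypothesis applies. *)
  have [w [wl wr]] := common_flag aF bF.
  have wF : w \in flags F by apply: wl.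
  have [wX wZ] : w \in flags X /\ w \in flags Z.
    by split; [apply: wl|apply: wr]; rewrite // rF ?rX ?rZ; lia.
  case: (cayley_diamond rX rZ xX xZ wX wZ) => xw; [left|right]; rewrite (proper_face_eq _ rF wF) //.
  by rewrite invMg invr -mulgA.
have mid (w : cayley_maniplex) : w \in flags X -> w \in flags Z ->
    [/\ rank (face_at (proper_rank i) w) == i%:Z%R, (X <= face_at (proper_rank i) w)%O
       & (face_at (proper_rank i) w <= Z)%O].
  move=> wX wZ; rewrite rank_face_at eqxx.
  rewrite (face_le_flag wX (flags_face_at _ _)) (face_le_flag (flags_face_at _ _) wZ).
  by rewrite rank_face_at rX rZ; split=> //; lia.
by case=> /eqP->; apply: mid.
Qed.

Definition flag_chain (x : cayley_maniplex) : {set face cayley_maniplex} :=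
  [set face_at s x | s : 'I_n.+2].

Lemma mem_flag_chain (F : face cayley_maniplex) (x : cayley_maniplex) :
  (F \in flag_chain x) = (x \in flags F).
Proof.
apply/imsetP/idP => [[s _ ->]|xF]; first exact: flags_face_at.
by exists (val F).1; last exact: face_atE.
Qed.

(** A maximal chain above it is again the chain of a flag, hence has the same cardinality. *)
Lemma flag_chain_maximal x : is_maximal_chain (flag_chain x).
Proof.
have : is_chain (flag_chain x).
  apply/forall_inP => F; rewrite mem_flag_chain => xF; apply/forall_inP => G.
  rewrite mem_flag_chain => xG; rewrite /Order.comparable !(face_le_flag xF xG, face_le_flag xG xF).
  exact: Order.TotalTheory.le_total.
case/maxset_exists=> C maxC sxC; have [y eC] := maximal_chain_flag maxC.
suff -> : flag_chain x = C by [].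
apply/eqP; rewrite eqEcard sxC eC !card_imset ?leqnn //; exact: face_at_inj.
Qed.

Lemma eq_of_trivI x y :
  (forall i, x^-1 * y \in par [set~ i]) -> y = x.
Proof. by move/trivI/(canRL (mulKVg _)); rewrite mulg1. Qed.

(** The chains of 1 and [z] share their faces of ranks in [K]. A sequence of adjacent chains keeping
    these faces only multiplies by [r i] with i outside [K], which would put [z] into the subgroup
    generated by those. *)
Lemma cayley_not_polytopal K z :
  (forall i, i \in K -> z \in par [set~ i]) -> z \notin par (~: K) ->
  ~ polytopal cayley_maniplex.
Proof.
move=> zK nz [_ _ /(_ _ _ (flag_chain_maximal 1) (flag_chain_maximal z))[s [ps ls sI]]].
suff [x xK ezx] : exists2 x, x \in par (~: K) & flag_chain z = flag_chain x.
  case/negP: nz; rewrite (@eq_of_trivI x z) // => i.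
  by rewrite -mem_proper_face -mem_flag_chain ezx mem_flag_chain flags_face_at.
set B := flag_chain 1 :&: flag_chain z in sI.
have inK y k : B \subset flag_chain y -> k \in K -> y \in par [set~ k].
  move=> /subsetP/(_ (@face_at n cayley_maniplex (proper_rank k) (1 : gT))) yB kK.
  have := yB; rewrite !inE !mem_flag_chain flags_face_at !mem_proper_face !invg1 !mul1g.
  by apply; apply: zK.
(* Invariant of the induction: the current chain is that of an element of [par (~: K)]. *)
have : exists2 x, x \in par (~: K) & flag_chain 1 = flag_chain x by exists 1.
rewrite -ls; move: (flag_chain 1) ps {ls} => C; elim: s C sI => [//|D s IH] C sI /=.
case/andP=> /existsP[i /andP[nCD /forallP CD]] ps [x xK eCx].
apply: IH ps _ => [E Es|]; first by apply: sI; rewrite inE Es orbT.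
have [maxD BD] := sI D (mem_head _ _); have [y eDy] := maximal_chain_flag maxD.
have {}eDy : D = flag_chain y by [].
have parK k : k \in K -> par (~: K) \subset par [set~ k].
  by move=> kK; apply: parabolicS; rewrite subCset setCK sub1set.
have off j : j != i -> x^-1 * y \in par [set~ j].
  move=> ji; have := CD (@face_at n cayley_maniplex (proper_rank j) x).
  rewrite rank_face_at (inj_eq (_ : injective Posz)) ?ji; last by move=> ? ? [].
  by rewrite eDy eCx !mem_flag_chain flags_face_at mem_proper_face /= => /eqP.
have xy : x^-1 * y \notin par [set~ i].
  apply/negP => iy; case/eqP: nCD; rewrite eCx eDy (@eq_of_trivI x y) // => j.
  by have [->//|] := eqVneq j i; apply: off.
have iK : i \notin K.
  (* For i in [K] both [x] and [y] would lie in the shared face of rank i, against [xy]. *)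
  apply/negP => iK; case/negP: xy; rewrite groupMl ?groupV; last exact: (subsetP (parK _ iK)).
  by apply: inK; rewrite -?eDy.
exists y => //; suff -> : y = x * r i by rewrite groupM // mem_parabolic // inE.
have iy : r i * (x^-1 * y) \in par [set~ i].
  have [] // := @diamond i (x^-1 * y); last by rewrite (negPf xy).
    by move=> j ji; apply: off; apply/eqP => e; move: ji; rewrite e; lia.
  by move=> j ji; apply: off; apply/eqP => e; move: ji; rewrite e; lia.
(* This element lies in every [par [set~ j]]: by [diamond] for j = i, by [off] otherwise. *)
suff e : r i * (x^-1 * y) = 1.
  by rewrite -[y](mulKVg x) -[x^-1 * y](mulKg (r i)) e mulg1 invr.
apply: trivI => j; have [->//|ji] := eqVneq j i.
by rewrite groupM ?off // mem_parabolic // !inE eq_sym.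
Qed.

End CayleyManiplex.

(** Up to left multiplication by [b], every element is 1, [a], [a * b] or [a * b * a]. As [L]
    contains [b], only the first of these can lie in [L]. *)
Lemma dihedral8_inter (gT : finGroupType) (a b : gT) (L : {group gT}) :
  a * a = 1 -> b * b = 1 -> (a * b) ^+ 4 = 1 ->
  a \notin L -> b \in L -> a * b * a \notin L ->
  forall x, x \in <<[set a; b]>> -> x \in L -> x = 1 \/ x = b.
Proof.
move=> aa bb ab4 aL bL abaL x.
have baba : b * a * b * a = a * b * a * b.
  apply: (mulgI (a * b * a * b)); rewrite -!mulgA (mulgA b b) bb mul1g (mulgA a a) aa mul1g.
  by move: ab4; rewrite !expgS expg0 mulg1 -!mulgA => ->; rewrite (mulgA b b) bb mul1g aa.
(* One clause for each of the four right cosets of <b>. *)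
have : x \in <<[set a; b]>> -> exists2 y, y = 1 \/ y = b &
    [\/ x = y, x = y * a, x = y * a * b | x = y * a * b * a].
  move: x; apply: gen_ind => [|x s [y y1b xy] /set2P s_ab].
    by exists 1; [left|constructor 1].
  have yb : y * b = 1 \/ y * b = b by case: y1b => ->; [right; rewrite mul1g|left].
  case: s_ab => ->; case: xy => ->.
  - by exists y => //; constructor 2.
  - by exists y => //; constructor 1; rewrite -mulgA aa mulg1.
  - by exists y => //; constructor 4.
  - by exists y => //; constructor 3; rewrite -mulgA aa mulg1.
  - by exists (y * b) => //; constructor 1.
  - by exists y => //; constructor 3.
  - by exists y => //; constructor 2; rewrite -mulgA bb mulg1.
  - exists (y * b) => //; constructor 4.
    by rewrite -!mulgA; congr (_ * _); rewrite !mulgA baba.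
move=> H /H[y y1b]; have yL : y \in L by case: y1b => ->.
case=> -> //; rewrite -?mulgA groupMl // ?(negPf aL) //.
  by rewrite groupMr // (negPf aL).
by rewrite mulgA (negPf abaL).
Qed.

(** * Relations among the generators that suffice for faithfulness and thinness *)

Section Criterion.
Variables (n : nat) (gT : finGroupType) (r : nat -> gT).
Hypothesis hn : 3 < n.
Hypothesis rr : forall i, r i * r i = 1.
Hypothesis far : forall i j, i.+1 < j -> commute (r i) (r j).
Hypothesis central : forall i j, 3 < i -> commute (r i) (r j).
Hypothesis ind : forall i : 'I_n, r i \notin parabolic r [set~ i].
Let par (P : pred nat) := parabolic r [set i : 'I_n | P i].

Lemma mem_par (P : pred nat) i : i < n -> P i -> r i \in par P.
Proof. by move=> lin Pi; apply: (@mem_parabolic n gT r _ (Ordinal lin)); rewrite inE. Qed.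

Lemma parS (P Q : pred nat) x : (forall i, i < n -> P i -> Q i) -> x \in par P -> x \in par Q.
Proof.
by move=> PQ; apply: (subsetP (parabolicS _ _)); apply/subsetP => i; rewrite !inE; apply: PQ.
Qed.

Lemma parC (i : 'I_n) : parabolic r [set~ i] = par (fun j => j != i).
Proof. by congr parabolic; apply/setP => j; rewrite !inE. Qed.

Lemma par_split (P Q R : pred nat) x :
  (forall i, i < n -> P i -> Q i || R i) ->
  (forall i j, Q i -> R j -> commute (r i) (r j)) ->
  x \in par P -> exists2 q, q \in par Q & exists2 s, s \in par R & x = q * s.
Proof.
move=> PQR QR xP.
have /mulsgP[q s qQ sR ->] : x \in par Q * par R.
  apply: (subsetP (parabolicU _)) (subsetP (parabolicS _ _) _ xP).
    by move=> i j; rewrite !inE; apply: QR.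
  by apply/subsetP => i; rewrite !inE; apply: PQR.
by exists q => //; exists s.
Qed.

Lemma par1 i x : x \in par (pred1 i) -> x = 1 \/ x = r i.
Proof.
move: x; apply: parabolic_ind => [|x j [->|->]]; first by left.
  by rewrite inE => /eqP->; right; rewrite mul1g.
by rewrite inE => /eqP->; left.
Qed.

Lemma par_delete (P : pred nat) i x :
  (forall j, P j -> commute (r i) (r j)) ->
  x \in par P -> x \in par (fun j => P j && (j != i)) \/
                 r i * x \in par (fun j => P j && (j != i)).
Proof.
move=> iP /(@par_split _ (pred1 i) (fun j => P j && (j != i)))[].
- by move=> j _ Pj /=; rewrite Pj; case: eqP.
- by move=> j k /eqP-> /andP[+ _]; apply: iP.
move=> q /par1[]-> [s sR ->]; [left|right]; first by rewrite mul1g.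
by rewrite mulgA rr mul1g.
Qed.

Lemma par_dihedral (a b : nat) (P R : pred nat) x :
  a < n -> b < n -> a != b -> (r a * r b) ^+ 4 = 1 -> r a * r b * r a \notin par (fun i => i != a) ->
  (forall i, i < n -> P i -> [|| i == a, i == b | R i]) ->
  (forall i, R i -> [/\ i != a, commute (r a) (r i) & commute (r b) (r i)]) ->
  x \in par P -> x \in par (fun i => i != a) -> x \in par R \/ r b * x \in par R.
Proof.
move=> an bn ab ord conj PR cR /(@par_split _ (pred2 a b) R)[].
- by move=> i lin /(PR i lin); rewrite /= orbA.
- by move=> i j /orP[]/eqP-> /cR[].
move=> q qab [s sR ->]; have sa : s \in par (fun i => i != a).
  by apply: parS sR => i _ /cR[].
rewrite (groupMr _ sa) => qa; have bL : r b \in par (fun i => i != a).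
  by apply: mem_par; rewrite // eq_sym.
have aL : r a \notin par (fun i => i != a).
  by have := ind (Ordinal an); rewrite parC.
have [|->|->] := dihedral8_inter (rr a) (rr b) ord aL bL conj _ qa.
- suff <- : [set r (i : 'I_n) | i in [set i : 'I_n | pred2 a b i]] = [set r a; r b] by [].
  apply/setP => y; rewrite !inE; apply/imsetP/orP => [[i + ->]|].
    by rewrite inE => /orP[]/eqP->; rewrite eqxx; [left|right].
  by case=> /eqP->; [exists (Ordinal an)|exists (Ordinal bn)]; rewrite // inE /= eqxx ?orbT.
- by left; rewrite mul1g.
by right; rewrite mulgA rr mul1g.
Qed.

Lemma criterion_word (K := [set i : 'I_n | (i == 0 :> nat) || (i == 3 :> nat)]) z :
  z = (r 0 * r 1 * r 2) ^+ 3 -> z = (r 1 * r 2 * r 3) ^+ 3 ->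
  z \notin par (fun i => (i != 0) && (i != 3)) ->
  (forall i, i \in K -> z \in parabolic r [set~ i]) /\ z \notin parabolic r (~: K).
Proof.
move=> z012 z123 nz; split=> [i|]; last first.
  suff -> : ~: K = [set i : 'I_n | (i != 0 :> nat) && (i != 3 :> nat)] by [].
  by apply/setP => i; rewrite !inE negb_or.
rewrite inE parC => /orP[]/eqP->; last by rewrite z012 groupX // !groupM // mem_par //; lia.
by rewrite z123 groupX // !groupM // mem_par //; lia.
Qed.

Hypothesis ord01 : (r 0 * r 1) ^+ 4 = 1.
Hypothesis conj0 : r 0 * r 1 * r 0 \notin par (fun i => i != 0).

Lemma inter02 x : x \in par (fun i => i != 2) -> x \in par (fun i => i != 0) ->
  x \in par (fun i => 2 < i) \/ r 1 * x \in par (fun i => 2 < i).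
Proof.
apply: par_dihedral => //; try lia; move=> i.
by move=> i2; split; [lia|apply: far; lia..].
Qed.

(** By [inter02] only generators beyond 2 remain, as the alternative would put [r 1] into the
    subgroup of the others. These remaining generators commute and are deleted one at a time,
    independence excluding the second outcome of [par_delete]. *)
Lemma criterion_trivI x : (forall i : 'I_n, x \in parabolic r [set~ i]) -> x = 1.
Proof.
move=> xI; have {}xI i : i < n -> x \in par (fun j => j != i).
  by move=> lin; have := xI (Ordinal lin); rewrite parC.
have sub3 y : y \in par (fun i => 2 < i) -> y \in par (fun i => i != 1%N).
  by apply: parS => i; lia.
have x3 : x \in par (fun i => 2 < i).
  have [||//|/sub3] := @inter02 x; try by apply: xI; lia.
  rewrite groupMr; last by apply: xI; lia.
  have l1n : 1 < n by lia.
  by have /negP := ind (Ordinal l1n); rewrite parC.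
have step i : 2 < i -> i <= n -> x \in par (fun j => i <= j).
  elim: i => // i IH; rewrite ltnS leq_eqVlt => /orP[/eqP<- _ //|i2 lin].
  have ci j : i <= j -> commute (r i) (r j).
    by rewrite leq_eqVlt => /orP[/eqP<-//|ij]; apply/commute_sym/central; lia.
  have [|xi] := par_delete ci (IH i2 (ltnW lin)); first by apply: parS => j; lia.
  have /negP[] := ind (Ordinal lin); rewrite parC -(groupMr _ (xI i lin)).
  by apply: parS xi => j; lia.
have : x \in par (fun j => n <= j) by apply: step; lia.
move: x {xI x3 step}; apply: parabolic_ind => // x i _.
by rewrite inE leqNgt ltn_ord.
Qed.

Hypothesis ord32 : (r 3 * r 2) ^+ 4 = 1.
Hypothesis conj3 : r 3 * r 2 * r 3 \notin par (fun i => i != 3).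

Lemma inter13 x : x \in par (fun i => i != 1%N) -> x \in par (fun i => i != 3) ->
  x \in par (fun i => (i == 0) || (3 < i)) \/ r 2 * x \in par (fun i => (i == 0) || (3 < i)).
Proof.
apply: par_dihedral => //; try lia; move=> i.
case/orP=> [/eqP->|i3]; split=> //; try lia; apply: commute_sym;
  by [apply: far | apply: central].
Qed.

Hypothesis gen : parabolic r [set: 'I_n] = [set: gT] :> {set gT}.

(** For i = 1 and i = 2 this is [inter02] and [inter13]. Otherwise [r i] commutes with every
    generator allowed in [x], and [par_delete] applies. *)
Lemma criterion_diamond (i : 'I_n) x :
  (forall j : 'I_n, j.+1 = i -> x \in parabolic r [set~ j]) ->
  (forall j : 'I_n, j = i.+1 :> nat -> x \in parabolic r [set~ j]) ->
  x \in parabolic r [set~ i] \/ r i * x \in parabolic r [set~ i].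
Proof.
move=> xl xr.
have {}xl j : j < n -> j.+1 = i -> x \in par (fun k => k != j).
  by move=> ljn e; have := xl (Ordinal ljn) e; rewrite parC.
have {}xr j : j < n -> j = i.+1 -> x \in par (fun k => k != j).
  by move=> ljn e; have := xr (Ordinal ljn) e; rewrite parC.
rewrite parC.
have del (P : pred nat) : (forall j, P j -> commute (r i) (r j)) -> x \in par P ->
    x \in par (fun k => k != i) \/ r i * x \in par (fun k => k != i).
  move=> iP /(par_delete iP)[] xP; [left|right];
    by apply: parS xP => j _ /andP[].
have [[i0|i1]|[i2|i3]] : (i = 0 :> nat \/ i = 1%N :> nat) \/ (i = 2 :> nat \/ 2 < i) by lia.
- apply: (del (fun j => j != 1%N)) => [j j1|]; last by apply: xr; lia.
  by rewrite i0; have [->//|j0] := eqVneq j 0; apply: far; lia.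
- have [||xP|xP] := @inter02 x; [by apply: xr; lia|by apply: xl; lia|left|right].
    by apply: parS xP => j; lia.
  by rewrite i1; apply: parS xP => j; lia.
- have [||xP|xP] := @inter13 x; [by apply: xl; lia|by apply: xr; lia|left|right].
    by apply: parS xP => j; lia.
  by rewrite i2; apply: parS xP => j; lia.
have [i3'|i4] : (i = 3 :> nat \/ 3 < i) by lia.
  apply: (del (fun j => j != 2)) => [j j2|]; last by apply: xl; lia.
  rewrite i3'; have [->//|j3] := eqVneq j 3.
  have [j4|j1] : 3 < j \/ j.+1 < 3 by lia.
    exact/commute_sym/central.
  exact/commute_sym/far.
apply: (del xpredT) => [j _|]; first exact: central.
by have := in_setT x; rewrite -gen.
Qed.

End Criterion.

(** * The explicit permutation group *)

Section Example.
Variables n k : nat.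
Hypothesis hn : 3 < n.

(* The two factors bool * bool are the four vertices and the four cells of the quotient
   honeycomb, each identified with F_2^2; the dihedral group acts on 'I_k.+2 as on Z/(k+2).
   In the last factor r_0 and r_3 share the coordinate 0: it separates (r_0 r_1 r_2)^3 from
   <r_1, r_2>. *)
Definition point : finType :=
  ((bool * bool) * (bool * bool) * 'I_k.+2 * {ffun 'I_n -> bool})%type.

Implicit Types (t : point) (g : {ffun 'I_n -> bool}) (i j : nat).

Definition toggle i g := [ffun j : 'I_n => (j == i :> nat) (+) g j].

Lemma toggleK i : involutive (toggle i).
Proof. by move=> g; apply/ffunP => j; rewrite !ffunE addbA addbb. Qed.

Lemma toggleC i j g : toggle i (toggle j g) = toggle j (toggle i g).
Proof. by apply/ffunP => l; rewrite !ffunE addbCA. Qed.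

(** Colours 0 and 3 translate the vertices and the cells respectively; colours 1 and 2 act linearly
    on both. Replacing i by 3-i exchanges the two planes. On Z/(k+2), colours 1 and 2 are the
    reflections in 0 and in 1/2. *)
Definition move i t : point :=
  let: ((a, b), (c, d), x, g) := t in
  match i with
  | 0 => ((~~ a, b), (c, d), x, toggle 0 g)
  | 1 => ((b, a), (c (+) d, d), (- x)%R, g)
  | 2 => ((a (+) b, b), (d, c), (1 - x)%R, g)
  | 3 => ((a, b), (~~ c, d), x, toggle 0 g)
  | _ => ((a, b), (c, d), x, toggle i g)
  end.

Lemma moveK i : involutive (move i).
Proof.
case=> [[[[a b] [c d]] x] g]; case: i => [|[|[|[|i]]]] /=; rewrite ?toggleK ?negbK //.
  by rewrite GRing.opprK -addbA addbb addbF.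
by rewrite GRing.subKr -addbA addbb addbF.
Qed.

Definition move_perm i : {perm point} := perm (can_inj (moveK i)).

Definition move_group := subg_of (parabolic move_perm [set: 'I_n]).

Definition rho i : move_group := subg _ (move_perm i).

(* For i >= n the map [move i] toggles no coordinate, so [move_perm i] is 1 and lies in the group. *)
Lemma sgval_rho i : sgval (rho i) = move_perm i.
Proof.
rewrite subgK //; have [lin|nlei] := ltnP i n; first exact: (mem_parabolic _ (in_setT (Ordinal lin))).
suff -> : move_perm i = 1 by exact: group1.
apply/permP => -[[[[a b] [c d]] x] g]; rewrite permE perm1 /=.
case: i nlei => [|[|[|[|i]]]] nlei /=; try by (exfalso; lia).
congr (_, _); apply/ffunP => j; rewrite !ffunE; case: eqP => // e.
by have := ltn_ord j; rewrite e ltnNge nlei.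
Qed.

Definition act (x : move_group) : point -> point := sgval x.

Lemma act1 t : act 1 t = t. Proof. exact: perm1. Qed.

Lemma actM x y t : act (x * y) t = act y (act x t). Proof. exact: permM. Qed.

Lemma act_rho i t : act (rho i) t = move i t.
Proof. by rewrite /act sgval_rho permE. Qed.

Lemma act_inj x y : (forall t, act x t = act y t) -> x = y.
Proof. by move=> xy; apply/val_inj/permP. Qed.

Definition actE := (act1, actM, act_rho, expgS, expg0).

Lemma rho_inv i : rho i * rho i = 1.
Proof. by apply: act_inj => t; rewrite !actE moveK. Qed.

Lemma rho_central i j : 3 < i -> commute (rho i) (rho j).
Proof.
move=> i4; apply: act_inj => -[[[[a b] [c d]] x] g]; rewrite !actE.
case: i i4 => [|[|[|[|i]]]] //= _.
by case: j => [|[|[|[|j]]]] //=; rewrite toggleC.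
Qed.

Lemma rho_far i j : i.+1 < j -> commute (rho i) (rho j).
Proof.
move=> ij; have [j4|j4] := ltnP 3 j; first exact/commute_sym/rho_central.
apply: act_inj => -[[[[a b] [c d]] x] g]; rewrite !actE.
case: i j ij j4 => [|[|i]] [|[|[|[|j]]]] //= _ _.
- by rewrite addNb.
- by rewrite addNb.
Qed.

Lemma rho_ord01 : (rho 0 * rho 1) ^+ 4 = 1.
Proof.
apply: act_inj => -[[[[a b] [c d]] x] g]; rewrite !actE /= !toggleK !GRing.opprK.
by case: a b c d => [] [] [] [].
Qed.

Lemma rho_ord32 : (rho 3 * rho 2) ^+ 4 = 1.
Proof.
apply: act_inj => -[[[[a b] [c d]] x] g]; rewrite !actE /= !toggleK !GRing.subKr.
by case: a b c d => [] [] [] [].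
Qed.

Lemma rho_word : (rho 0 * rho 1 * rho 2) ^+ 3 = (rho 1 * rho 2 * rho 3) ^+ 3.
Proof.
apply: act_inj => -[[[[a b] [c d]] x] g]; rewrite !actE /= !toggleK.
by case: a b c d => [] [] [] [].
Qed.

(** A set of points stable under the generators is stable under the subgroup. All independence
    statements below exhibit such a set and a point that [x] moves out of it. *)
Lemma notin_parabolic (J : {set 'I_n}) (A : pred point) t x :
  (forall (i : 'I_n) s, i \in J -> A s -> A (move i s)) -> A t -> ~~ A (act x t) ->
  x \notin parabolic rho J.
Proof.
move=> AJ At; apply: contra => xJ; move: x xJ {At} t (At : A t).
apply: parabolic_ind => [|x i IH iJ] t At; rewrite !actE //.
by apply: AJ; last exact: IH.
Qed.

Lemma rho_gen : parabolic rho [set: 'I_n] = [set: move_group] :> {set move_group}.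
Proof.
apply/setP => x; rewrite inE -(sgvalK x); move: (sgval x) (subgP x).
pose G := parabolic move_perm [set: 'I_n].
(* Membership in [G] is carried along because [subg] is multiplicative only on [G]. *)
suff H y : y \in G -> y \in G /\ subg G y \in parabolic rho [set: 'I_n] by move=> y /H[].
move: y; apply: parabolic_ind => [|y i [yG IH] iJ]; first by rewrite group1 morph1 group1.
have iG : move_perm i \in G by apply: mem_parabolic.
split; first exact: groupM.
by rewrite morphM // groupM // (mem_parabolic rho iJ).
Qed.

Definition base (a c : bool) : point := ((a, false), (c, false), 0%R, [ffun => false]).

Lemma conj0_notin : rho 0 * rho 1 * rho 0 \notin parabolic rho [set i : 'I_n | i != 0 :> nat].
Proof.
apply: (@notin_parabolic _ (fun t => t.1.1.1 == (false, false)) (base false false));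
  rewrite ?actE //.
case=> [[|[|[|[|i]]]] lin] [[[[a b] [c d]] x] g] //=; rewrite inE //= => _ /eqP[-> ->] //.
Qed.

Lemma conj3_notin : rho 3 * rho 2 * rho 3 \notin parabolic rho [set i : 'I_n | i != 3 :> nat].
Proof.
apply: (@notin_parabolic _ (fun t => t.1.1.2 == (false, false)) (base false false));
  rewrite ?actE //.
case=> [[|[|[|[|i]]]] lin] [[[[a b] [c d]] x] g] //=; rewrite inE //= => _ /eqP[-> ->] //.
Qed.

Lemma word_notin : (rho 0 * rho 1 * rho 2) ^+ 3 \notin
  parabolic rho [set i : 'I_n | (i != 0 :> nat) && (i != 3 :> nat)].
Proof.
have l0n : 0 < n by lia.
(* Only [r_0] and [r_3] toggle coordinate 0, and the word toggles it three times. *)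
apply: (@notin_parabolic _ (fun t => ~~ t.2 (Ordinal l0n)) (base false false));
  rewrite ?actE /= ?ffunE //=.
by case=> [[|[|[|[|i]]]] lin] [[[[a b] [c d]] x] g] //=; rewrite inE //= ffunE.
Qed.

Lemma rho_ind (i : 'I_n) : rho i \notin parabolic rho [set~ i].
Proof.
(* Each set is preserved by all colours but i: the zero vertex, the second coordinate of a vertex or
   of a cell, the zero cell, or coordinate i. *)
pose A t := match nat_of_ord i with
  | 0 => t.1.1.1 == (false, false)
  | 1 => ~~ t.1.1.1.2
  | 2 => ~~ t.1.1.2.2
  | 3 => t.1.1.2 == (false, false)
  | _ => ~~ t.2 i
  end.
(* For i = 1 or 2 the start is (1,0) in the relevant plane, so that the swap alters its second
   coordinate. *)
apply: (@notin_parabolic _ A (base (i == 1%N :> nat) (i == 2 :> nat))).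
- case=> j lj [[[[a b] [c d]] x] g]; rewrite !inE -val_eqE /A {A} /=.
  by case: i j {lj} => [[|[|[|[|i]]]] li] [|[|[|[|j]]]] //= ij; rewrite ?ffunE //=;
    do ?[case/eqP=> -> -> //]; rewrite eq_sym (negPf ij).
- by rewrite /A /=; case: i {A} => [[|[|[|[|i]]]] li] //=; rewrite ffunE.
- by rewrite /A act_rho; case: i {A} => [[|[|[|[|i]]]] li] //=; rewrite !ffunE eqxx.
Qed.

(** The product [rho 1 * rho 2] acts on Z/(k+2) as adding 1, so it has at least k+2 distinct
    powers. *)
Lemma card_move_group : k < #|{: move_group}|.
Proof.
pose t0 := base false false.
have e m : (act ((rho 1 * rho 2) ^+ m) t0).1.2 = (m%:R : 'I_k.+2)%R.
  elim: m => [|m IH]; first by rewrite !actE.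
  rewrite expgSr !actM !act_rho; move: IH; case: (act _ t0) => [[[[a b] [c d]] x] g] /= ->.
  by rewrite GRing.opprK GRing.mulrSr GRing.addrC.
have inj : injective (fun i : 'I_k.+2 => (rho 1 * rho 2) ^+ i).
  move=> i j ij; have := e i; rewrite ij e => /eqP.
  by rewrite !Zp_nat => /eqP/(congr1 val) /=; rewrite !modn_small // => /esym/val_inj.
have := leq_card _ inj; rewrite card_ord; exact: ltnW.
Qed.

Definition example : maniplex n := cayley_maniplex rho_gen rho_inv rho_far rho_ind.

Lemma example_correct :
  [/\ regular example, faithful example, thin example & ~ polytopal example].
Proof.
have trivI := criterion_trivI hn rho_inv rho_far rho_central rho_ind
  rho_ord01 conj0_notin.
have diamond := criterion_diamond hn rho_inv rho_far rho_central rho_ind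
  rho_ord01 conj0_notin rho_ord32 conj3_notin rho_gen.
have [zK nz] := criterion_word hn (erefl _) rho_word word_notin.
split; [exact: cayley_regular|exact: cayley_faithful|exact: cayley_thin|].
exact: cayley_not_polytopal zK nz.
Qed.

End Example.

Theorem theorem1 (n : nat) (hn : (3 < n)%N) :
  exists M : nat -> maniplex n,
    (forall k, [/\ regular (M k), faithful (M k), thin (M k) & ~ polytopal (M k)])
    /\ (forall j k, j <> k -> ~ isomorphic (M j) (M k)).
Proof.
(* Each parameter is the number of flags of the preceding example, which exceeds the preceding
   parameter; hence the numbers of flags, [s j.+1], strictly increase. *)
pose s j := iter j (fun k => #|example k hn|) 0.
exists (fun j => example (s j) hn); split=> [k|j k jk [f [bij_f _]]].
  exact: example_correct.
have s_inc : {homo s : a b / a < b}.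
  by apply: homo_ltn => [a b c|a]; [apply: ltn_trans|apply: card_move_group].
have e : s j.+1 = s k.+1 by apply: bij_eq_card bij_f.
by case: (ltngtP j.+1 k.+1) => [/s_inc|/s_inc|[//]]; rewrite e ltnn.
Qed.
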